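(* Fix $r\ge 1$ and $m\ge1$, and let $(X_n)_{n\ge1}\in\mathcal{I}_{r,m}$. Then for each $k\ge1$ there exists a polynomial $p(n)$ of degree at most $mk$ such that for every $n\ge1$ and every conjugacy class $C_{\boldsymbol{\lambda}_n}$ of $\mathfrak{S}_{n,r}$ with no cycles of length $1,2,\ldots,mk$, we have $p(n)=\mathbb{E}_{\boldsymbol{\lambda}_n}[X_n^k]$.
   Context: The colored permutation group $\mathfrak{S}_{n,r}=\mathbb{Z}_r\wr\mathfrak{S}_n$ consists of pairs $(\omega,\tau)$ with $\omega\in\mathfrak{S}_n$, $\tau:[n]\to\mathbb{Z}_r$, acting on $\{i^c\}$ by $(\omega,\tau)(i^c)=\omega(i)^{\tau(\omega(i))+c}$. A cycle of $(\omega,\tau)$ is a cycle of $\omega$, with length its length and color the sum of $\tau(j)$ over its elements. Conjugacy classes $C_{\boldsymbol{\lambda}}$ are the sets of elements with a given multiset of (length, color) of cycles; $\mathbb{E}_{\boldsymbol{\lambda}}$ is expectation under the uniform distribution on $C_{\boldsymbol{\lambda}}$. A partial colored permutation of size $m$ is $(K,\kappa)$ with $K=\{(i_h,j_h)\}_{h=1}^m$, $i_h$ distinct, $j_h$ distinct, and $\kappa:\{j_h\}\to\mathbb{Z}_r$; $I_{(K,\kappa)}$ is the indicator that $\omega(i_h)=j_h$ and $\tau(j_h)=\kappa(j_h)$ for all $h$. The support is $\{i_1,\dots,i_m,j_1,\dots,j_m\}$; for an order-preserving injection $f$, $f(K,\kappa)=(\{(f(i_h),f(j_h))\},\{(f(j_h),\kappa(j_h))\})$.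 A set $\mathcal{C}$ of partial colored permutations on $\mathfrak{S}_{n_0,r}$ is order-invariant if all members have the same size and it is closed under $f(K,\kappa)$ for all order-preserving $f:\operatorname{supp}(K,\kappa)\to[n_0]$. Its $r$-colored order-invariant extension (for $n_0\ge2$) is the sequence $X_n=\sum_{(K,\kappa)\in\mathcal{C}_n}I_{(K,\kappa)}$ where $\mathcal{C}_n$ is the set of members of $\mathcal{C}$ with support in $[n]$ if $n\le n_0$, and the set of $f(K,\kappa)$, $(K,\kappa)\in\mathcal{C}$, $f:[n_0]\to[n]$ order-preserving, if $n\ge n_0$. $\mathcal{I}_{r,m}$ is the real vector space of sequences $(Y_n)_{n\ge1}$ of statistics ($Y_n$ on $\mathfrak{S}_{n,r}$), with componentwise operations, spanned by the $r$-colored order-invariant extensions of order-invariant sets consisting of partial colored permutations of size at most $m$. *)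

(* Defs.v *)
From HB Require Import structures.
From mathcomp Require Import all_boot all_order all_algebra all_fingroup.
From mathcomp Require Import reals.

Set Implicit Arguments.
Unset Strict Implicit.
Unset Printing Implicit Defensive.

Import GRing.Theory.
Local Open Scope ring_scope.

(* The cyclic group Z_r for r >= 1.  MathComp's 'Z_r is not used because 'Z_1
   has two elements. *)
Notation Zcol r := 'I_(r.-1.+1).

(* The set [n] = {1, ..., n} is represented by 'I_n = {0, ..., n - 1}. *)

Record cperm (r n : nat) := CPerm {
  cp_perm : 'S_n;
  cp_col : {ffun 'I_n -> Zcol r} }.

Section ColoredPermutations.
Variables r n : nat.
Implicit Types x y z : cperm r n.

Definition cperm_pair x : 'S_n * {ffun 'I_n -> Zcol r} := (cp_perm x, cp_col x).
Definition pair_cperm (p : 'S_n * {ffun 'I_n -> Zcol r}) : cperm r n :=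
  CPerm p.1 p.2.
Lemma cperm_pairK : cancel cperm_pair pair_cperm. Proof. by case. Qed.
HB.instance Definition _ := Equality.copy (cperm r n) (can_type cperm_pairK).
HB.instance Definition _ := Choice.copy (cperm r n) (can_type cperm_pairK).
HB.instance Definition _ := Countable.copy (cperm r n) (can_type cperm_pairK).
HB.instance Definition _ := Finite.copy (cperm r n) (can_type cperm_pairK).

(* The pair (i, c) stands for i^c. *)
Definition cp_act x (p : 'I_n * Zcol r) : 'I_n * Zcol r :=
  (cp_perm x p.1, cp_col x (cp_perm x p.1) + p.2).

(* As for 'S_n in MathComp, x * y is "first x, then y"; see cp_actM. *)
Definition cp_one : cperm r n := CPerm 1%g [ffun _ => 0].
Definition cp_mul x y : cperm r n :=
  CPerm (cp_perm x * cp_perm y)%g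
    [ffun j => cp_col x ((cp_perm y)^-1%g j) + cp_col y j].
Definition cp_inv x : cperm r n :=
  CPerm (cp_perm x)^-1%g [ffun j => - cp_col x (cp_perm x j)].

Lemma cp_mulA : associative cp_mul.
Proof.
move=> x y z; rewrite /cp_mul /= mulgA; congr CPerm.
by apply/ffunP=> j; rewrite !ffunE /= invMg permM addrA.
Qed.
Lemma cp_mul1 : left_id cp_one cp_mul.
Proof.
case=> s t; rewrite /cp_mul /= mul1g; congr CPerm.
by apply/ffunP=> j; rewrite !ffunE add0r.
Qed.
Lemma cp_mulV : left_inverse cp_one cp_inv cp_mul.
Proof.
case=> s t; rewrite /cp_mul /= mulVg; congr CPerm.
by apply/ffunP=> j; rewrite !ffunE permKV addNr.
Qed.
HB.instance Definition _ :=
  Finite_isGroup.Build (cperm r n) cp_mulA cp_mul1 cp_mulV.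

Lemma cp_actM x y p : cp_act (x * y)%g p = cp_act y (cp_act x p).
Proof. by rewrite /cp_act /= ffunE permM permK addrCA addrA. Qed.

(* The multiset of the (length, color) of the cycles, as a sequence that is to
   be considered up to perm_eq. *)
Definition cycle_type x : seq (nat * Zcol r) :=
  [seq (#|c|, \sum_(j in c) cp_col x j)
     | c : {set 'I_n} <- enum (porbits (cp_perm x))].

(* The class C_lam.  When nonempty it is a conjugacy class of the group cperm r n,
   and every conjugacy class is of this form; see cycle_class_conj. *)
Definition cycle_class (lam : seq (nat * Zcol r)) : {set cperm r n} :=
  [set x | perm_eq (cycle_type x) lam].

End ColoredPermutations.

Section PartialColoredPermutations.
Variable r : nat.

(* (K, kappa), with the function kappa given by its graph. *)
Definition pcperm n : finType :=
  ({set 'I_n * 'I_n} * {set 'I_n * Zcol r})%type.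

Definition dom1 n (P : pcperm n) : {set 'I_n} := [set e.1 | e in P.1].
Definition dom2 n (P : pcperm n) : {set 'I_n} := [set e.2 | e in P.1].

Definition is_pcperm n (P : pcperm n) : Prop :=
  [/\ {in P.1 &, injective fst}, {in P.1 &, injective snd},
      {in P.2 &, injective fst} & [set q.1 | q in P.2] = dom2 P].

Definition pc_size n (P : pcperm n) : nat := #|P.1|.
Definition pc_supp n (P : pcperm n) : {set 'I_n} := dom1 P :|: dom2 P.

Definition pc_indic n (P : pcperm n) (x : cperm r n) : bool :=
  [forall e in P.1, cp_perm x e.1 == e.2] &&
  [forall q in P.2, cp_col x q.1 == q.2].

Definition pc_map n n' (f : 'I_n -> 'I_n') (P : pcperm n) : pcperm n' :=
  ([set (f e.1, f e.2) | e in P.1], [set (f q.1, q.2) | q in P.2]).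

Definition order_preserving_on n n' (A : {set 'I_n}) (f : 'I_n -> 'I_n') : Prop :=
  {in A &, forall i j : 'I_n, (i < j)%N -> (f i < f j)%N}.

(* f is a total function of which only the values on supp P matter. *)
Definition order_invariant n (C : {set pcperm n}) : Prop :=
  [/\ forall P, P \in C -> is_pcperm P,
      forall P Q, P \in C -> Q \in C -> pc_size P = pc_size Q
    & forall P (f : 'I_n -> 'I_n), P \in C ->
        order_preserving_on (pc_supp P) f -> pc_map f P \in C].

(* For n <= n0 the function f is the inclusion of [n] in [n0], so that the first
   case is the set of members of C with support in [n]. *)
Definition oi_ext_set n0 (C : {set pcperm n0}) n : {set pcperm n} :=
  if (n <= n0)%N then
    [set P : pcperm n | [exists f : {ffun 'I_n -> 'I_n0},
       [forall i, f i == i :> nat] && (pc_map f P \in C)]]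
  else
    [set P : pcperm n | [exists f : {ffun 'I_n0 -> 'I_n},
       [forall i : 'I_n0, forall j : 'I_n0, (i < j)%N ==> (f i < f j)%N] &&
       [exists Q in C, P == pc_map f Q]]].

Variable R : realType.

(* Sequences of statistics; the component of index 0 is irrelevant. *)
Definition statistics : Type := forall n : nat, cperm r n -> R.

Definition oi_ext n0 (C : {set pcperm n0}) : statistics :=
  fun n x => \sum_(P in oi_ext_set C n) (pc_indic P x)%:R.

Definition is_oi_ext (m : nat) (Y : statistics) : Prop :=
  exists n0 (C : {set pcperm n0}),
    [/\ (2 <= n0)%N, order_invariant C,
        forall P, P \in C -> (pc_size P <= m)%N & Y = oi_ext C].

Definition in_I (m : nat) (X : statistics) : Prop :=
  exists N (a : 'I_N -> R) (Y : 'I_N -> statistics),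
    (forall l, is_oi_ext m (Y l)) /\
    forall n (x : cperm r n), (1 <= n)%N -> X n x = \sum_(l < N) a l * Y l n x.

Definition expectation (T : finType) (A : {set T}) (f : T -> R) : R :=
  (\sum_(x in A) f x) / #|A|%:R.

End PartialColoredPermutations.

Section ConjugacyClasses.

Lemma perm_eq_map_inj (T U : eqType) (V : eqType) (x0 : U) (f : T -> V)
    (h : U -> V) (s : seq T) (t : seq U) :
    uniq s -> uniq t -> perm_eq (map f s) (map h t) ->
  exists phi : T -> U, {in s, forall x, phi x \in t /\ h (phi x) = f x}
                       /\ {in s &, injective phi}.
Proof.
elim: s t => [|a s IH] t /=.
  by move=> _ _ _; exists (fun _ => x0); split.
case/andP=> a_s us ut e.
have /mapP[b bt eb] : f a \in map h t.
  by rewrite -(perm_mem e) inE eqxx.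
have et := perm_to_rem bt.
have e' : perm_eq (map f s) (map h (rem b t)).
  rewrite -(perm_cons (f a)) (permPl e) eb -map_cons.
  exact: perm_map.
have [phi [H1 H2]] := IH _ us (rem_uniq b ut) e'.
have H3 x : x \in s -> phi x != b /\ phi x \in t.
  move=> /H1[]; rewrite mem_rem_uniq // inE => /andP[xb xt] _.
  by split.
exists (fun x => if x == a then b else phi x); split=> [x|x y].
  rewrite inE; case: eqP => [-> _|_ /= xs]; first by [].
  by split; [case: (H3 x xs) | case: (H1 x xs)].
rewrite !inE; case: (eqVneq x a) => [->|_] /=; case: (eqVneq y a) => [->|_] //=.
- by move=> _ /H3[/eqP + _] eyb => /(_ (esym eyb)).
- by move=> /H3[/eqP + _] _ eyb => /(_ eyb).
- exact: H2.
Qed.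

Section Orbits.
Variables (T : finType) (s : {perm T}) (a : T).
Let l := #|porbit s a|.

Lemma porbit_gt0 : (0 < l)%N.
Proof. by rewrite lt0n card_porbit_neq0. Qed.

Lemma porbit_period i : (s ^+ i)%g a = (s ^+ (i %% l))%g a.
Proof.
rewrite !permX {1}(divn_eq i l) addnC iterD; congr (iter _ _ _).
by elim: (i %/ l)%N => //= q IH; rewrite mulSn iterD IH iter_porbit.
Qed.

Lemma porbit_inj i j : (s ^+ i)%g a = (s ^+ j)%g a -> i = j %[mod l].
Proof.
rewrite porbit_period [RHS]porbit_period => e.
have [li lj] : (i %% l < l)%N /\ (j %% l < l)%N by rewrite !ltn_mod porbit_gt0.
apply/eqP; rewrite -(nth_uniq a _ _ (uniq_traject_porbit s a)) ?size_traject //.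
by rewrite !nth_traject // -!permX e.
Qed.

Lemma sum_porbit (V : zmodType) (F : T -> V) :
  \sum_(t < l) F ((s ^+ t.+1)%g a) = \sum_(j in porbit s a) F j.
Proof.
have -> : \sum_(j in porbit s a) F j = \sum_(j in porbit s a) F (s j).
  rewrite (reindex_inj (@perm_inj _ s)) /=; apply: eq_bigl => j.
  have := porbit_perm s 1 j; rewrite expg1 => e.
  by rewrite porbit_sym -eq_porbit_mem eq_sym -[RHS]porbit_sym
    -[RHS]eq_porbit_mem eq_sym e.
rewrite -(eq_bigl _ _ (fun j => esym (porbit_traject s a j))).
rewrite -big_uniq ?uniq_traject_porbit //=.
rewrite (big_nth a) size_traject big_mkord; apply: eq_bigr => i _.
by rewrite nth_traject // permX.
Qed.
End Orbits.

Section Conj.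
Variables r n : nat.
Implicit Types x y g : cperm r n.

Lemma cp_permM x y : cp_perm (x * y)%g = (cp_perm x * cp_perm y)%g.
Proof. by []. Qed.
Lemma cp_colM x y j :
  cp_col (x * y)%g (cp_perm y j) = cp_col x j + cp_col y (cp_perm y j).
Proof. by rewrite ffunE permK. Qed.

Lemma cp_ext x y : cp_perm x = cp_perm y ->
  (forall u, cp_col x (cp_perm x u) = cp_col y (cp_perm y u)) -> x = y.
Proof.
case: x y => s t [s' t'] /= <- H; congr CPerm; apply/ffunP=> j.
by rewrite -[j](permKV s).
Qed.

Lemma cp_conjP x y g :
  y = (x ^ g)%g <->
  forall u, cp_perm g (cp_perm x u) = cp_perm y (cp_perm g u) /\
    cp_col x (cp_perm x u) + cp_col g (cp_perm g (cp_perm x u)) =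
    cp_col g (cp_perm g u) + cp_col y (cp_perm y (cp_perm g u)).
Proof.
have -> : (y = (x ^ g)%g) <-> (g * y = x * g)%g.
  by rewrite (conjgC x g); split=> [->|/mulgI].
split=> [e u|H].
  have e1 : cp_perm g (cp_perm x u) = cp_perm y (cp_perm g u).
    by rewrite -!permM -!cp_permM e.
  by split=> //; rewrite -!cp_colM -e e1.
have e : (cp_perm g * cp_perm y = cp_perm x * cp_perm g)%g.
  by apply/permP=> u; rewrite !permM; case: (H u).
apply: cp_ext => [//|u]; rewrite !cp_permM !permM !cp_colM.
by case: (H u) => _ ->.
Qed.

Lemma cycle_typeJ x g : perm_eq (cycle_type (x ^ g)%g) (cycle_type x).
Proof.
have H := (cp_conjP x (x ^ g)%g g).1 erefl.
move: (x ^ g)%g H => y; set h := cp_perm g => H.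
have Hk k u : h ((cp_perm x ^+ k)%g u) = (cp_perm y ^+ k)%g (h u).
  elim: k u => [|k IH] u; first by rewrite !expg0 !perm1.
  by rewrite !expgSr !permM -IH; case: (H ((cp_perm x ^+ k)%g u)).
have hp u : porbit (cp_perm y) (h u) = h @: porbit (cp_perm x) u.
  apply/setP=> v; apply/porbitP/imsetP => [[k ->]|[w /porbitP[k ->] ->]].
    by exists ((cp_perm x ^+ k)%g u); rewrite ?mem_porbit ?Hk.
  by exists k; rewrite Hk.
have inj_h : injective (fun c : {set 'I_n} => h @: c).
  exact: (imset_inj (@perm_inj _ h)).
have e : perm_eq (enum (porbits (cp_perm y)))
    [seq h @: c | c : {set 'I_n} <- enum (porbits (cp_perm x))].
  apply: uniq_perm; rewrite ?enum_uniq ?(map_inj_uniq inj_h) ?enum_uniq //.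
  move=> c; rewrite mem_enum; apply/imsetP/mapP => [[u _ ->]|[c' +  ->]].
    exists (porbit (cp_perm x) ((h^-1)%g u)).
      by rewrite mem_enum; apply/imsetP; exists ((h^-1)%g u).
    by rewrite -hp permKV.
  by rewrite mem_enum => /imsetP[u _ ->]; exists (h u); rewrite ?hp.
rewrite /cycle_type (permPl (perm_map _ e)) -map_comp.
rewrite (_ : map _ _ = cycle_type x) //; apply/eq_in_map => c.
rewrite mem_enum => /imsetP[a _ ->] /=.
rewrite card_imset; last exact: perm_inj.
congr pair; rewrite -hp -!sum_porbit hp card_imset; last exact: perm_inj.
under eq_bigr => t _.
  rewrite -Hk expgSr permM -/h.
  have -> : cp_col y (h (cp_perm x ((cp_perm x ^+ t)%g a))) =
     cp_col x ((cp_perm x ^+ t.+1)%g a) +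
     (cp_col g (h ((cp_perm x ^+ t.+1)%g a)) - cp_col g (h ((cp_perm x ^+ t)%g a))).
    have [e1 e2] := H ((cp_perm x ^+ t)%g a).
    by rewrite expgSr permM addrA e2 -e1 addrC addKr.
  over.
rewrite big_split /= -(big_mkord xpredT (fun t =>
  cp_col g (h ((cp_perm x ^+ t.+1)%g a)) - cp_col g (h ((cp_perm x ^+ t)%g a)))).
by rewrite telescope_sumr // permX iter_porbit perm1 subrr addr0.
Qed.

Lemma cycle_type_conj x y :
  perm_eq (cycle_type x) (cycle_type y) -> exists g, y = (x ^ g)%g.
Proof.
move=> e.
have [phi [phiP phi_inj]] := perm_eq_map_inj set0 (enum_uniq _) (enum_uniq _) e.
set s := cp_perm x in phiP phi_inj *; set s' := cp_perm y in phiP phi_inj *.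
pose A u := odflt u [pick v in porbit s u].
pose B u := odflt u [pick v in phi (porbit s u)].
have memp u : porbit s u \in enum (porbits s).
  by rewrite mem_enum; apply/imsetP; exists u.
have AP u : A u \in porbit s u.
  by rewrite /A; case: pickP => //= /(_ u); rewrite porbit_id.
have BP u : phi (porbit s u) = porbit s' (B u).
  have [+ _] := phiP _ (memp u); rewrite mem_enum => /imsetP[b _ eb].
  rewrite /B eb; case: pickP => [v|/(_ b)]; last by rewrite porbit_id.
  by rewrite /= -eq_porbit_mem => /eqP->.
have AE u v : porbit s u = porbit s v -> A u = A v.
  rewrite /A => ->; case: pickP => //= /(_ v); by rewrite porbit_id.
have BE u v : porbit s u = porbit s v -> B u = B v.
  move=> e1; have := BP v; rewrite /B e1; case: pickP => //= H2.
  by move: (BP v) => H1; have := H2 (B v); rewrite H1 porbit_id.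
have pA u : porbit s (A u) = porbit s u by apply/eqP; rewrite eq_porbit_mem AP.
have [K KP] : exists K : 'I_n -> nat, forall u, u = (s ^+ K u)%g (A u).
  apply: (@fin_all_exists _ _ (fun u k => u = (s ^+ k)%g (A u))) => u.
  by apply/porbitP; rewrite pA porbit_id.
have card_eq u : #|porbit s' (B u)| = #|porbit s (A u)|.
  by have [_ [+ _]] := phiP _ (memp u); rewrite BP pA.
have col_eq u : \sum_(j in porbit s' (B u)) cp_col y j
    = \sum_(j in porbit s (A u)) cp_col x j.
  by have [_ [_ +]] := phiP _ (memp u); rewrite BP pA.
pose G u := (s' ^+ K u)%g (B u).
have GP u i : G ((s ^+ i)%g (A u)) = (s' ^+ i)%g (B u).
  set v := (s ^+ i)%g (A u).
  have ev : porbit s v = porbit s u by rewrite porbit_perm pA.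
  have := KP v; rewrite (AE _ _ ev) {1}/v => /porbit_inj k_eq.
  by rewrite /G (BE _ _ ev) porbit_period card_eq -k_eq -card_eq -porbit_period.
have Ginj : injective G.
  move=> u v e1.
  have ep : porbit s u = porbit s v.
    apply: phi_inj; rewrite ?memp // !BP.
    by rewrite -(porbit_perm s' (K u)) -[RHS](porbit_perm s' (K v)) -/(G u) e1.
  move: e1; rewrite /G (BE _ _ ep) => /porbit_inj; rewrite card_eq => k_eq.
  by rewrite (KP u) (KP v) (AE _ _ ep) porbit_period k_eq -porbit_period.
pose D u t := cp_col x ((s ^+ t.+1)%g (A u)) - cp_col y ((s' ^+ t.+1)%g (B u)).
pose L u i := - \sum_(0 <= t < i) D u t.
have Dper u t : D u t = D u (t %% #|porbit s (A u)|)%N.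
  by rewrite /D !expgSr !permM porbit_period [(s' ^+ t)%g _]porbit_period card_eq.
have Lper u i : L u i = L u (i %% #|porbit s (A u)|)%N.
  set l := #|_|.
  have L0 : \sum_(0 <= t < l) D u t = 0.
    rewrite big_mkord sumrB sum_porbit /l -card_eq (sum_porbit s' (B u)) col_eq.
    by rewrite subrr.
  rewrite {1}(divn_eq i l) /L; congr (- _).
  elim: (i %/ l)%N => [|q IH]; first by rewrite mul0n add0n.
  rewrite mulSn -addnA (@big_cat_nat _ _ _ l) ?leq_addr //= L0 add0r.
  rewrite -{1}[l]add0n big_addn addKn -IH; apply: eq_bigr => t _.
  by rewrite Dper modnDr -Dper.
pose c u := L u (K u).
have cP u i : c ((s ^+ i)%g (A u)) = L u i.
  set v := (s ^+ i)%g (A u).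
  have ev : porbit s v = porbit s u by rewrite porbit_perm pA.
  have := KP v; rewrite (AE _ _ ev) {1}/v => /porbit_inj k_eq.
  by rewrite /c /L /D (AE _ _ ev) (BE _ _ ev) -/(D u) -/(L u _) Lper -k_eq -Lper.
exists (CPerm (perm Ginj) [ffun j => c ((perm Ginj)^-1%g j)]).
apply/cp_conjP => u /=; rewrite -/s -/s' !ffunE !permK !permE.
have su : s u = (s ^+ (K u).+1)%g (A u) by rewrite expgSr permM -KP.
have e1 : G (s u) = s' (G u) by rewrite su GP expgSr permM.
split=> //; rewrite {2}su cP {1}/L big_nat_recr //= opprD /D /c /L.
rewrite -su expgSr permM -/(G u) addrC -addrA opprB addrNK.
by [].
Qed.

Theorem cycle_class_conj x : cycle_class n (cycle_type x) = (x ^: [set: cperm r n])%g.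
Proof.
apply/setP=> y; rewrite inE; apply/idP/imsetP => [|[g _ ->]]; last exact: cycle_typeJ.
by rewrite perm_sym => /cycle_type_conj[g ->]; exists g; rewrite ?inE.
Qed.
End Conj.
End ConjugacyClasses.

(* Main.v *)
Require Import Defs.
From mathcomp Require Import all_boot all_order all_algebra all_fingroup.
From mathcomp Require Import reals zify ring.

(* Write [X_n] as the sum over all pairs [P] of [a_n(P) * I_P], where [a] is
   invariant under increasing relabelings and vanishes unless [P] has size at most
   [m].  Since [I_P * I_Q = I_(P :|: Q)], such expansions multiply, with the sizes
   adding up, so [X_n ^ k] has one with size at most [N := m * k].  On a class whose
   cycles are all longer than [N], [I_P] has mean [0] unless [P] is a disjoint union
   of paths; in that case the mean is [1 / (r^s (n-1) ... (n-s))] with [s] the size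
   of [P], whatever the lengths of the paths.  Grouping the terms by the support,
   of size [t <= 2s], gives a combination of ['C(n, t) / ((n-1) ... (n-s))], a
   polynomial of degree [t - s <= N] because [t > s] when [s > 0]. *)

Set Implicit Arguments.
Unset Strict Implicit.
Unset Printing Implicit Defensive.

Import Order.TTheory GRing.Theory Num.Theory.
Local Open Scope ring_scope.

(** * Increasing maps and transport along them *)

Definition increasing n n' (f : 'I_n -> 'I_n') : Prop :=
  forall i j : 'I_n, (i < j)%N -> (f i < f j)%N.

Lemma increasing_inj n n' (f : 'I_n -> 'I_n') : increasing f -> injective f.
Proof.
move=> fi i j e; apply: val_inj; by case: (ltngtP i j) => // /fi; rewrite e ltnn.
Qed.

Lemma increasing_enum n (A : {set 'I_n}) t : #|A| = t ->
  exists2 f : 'I_t -> 'I_n, increasing f & f @: setT = A.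
Proof.
move=> <-; exists enum_val => [i j ij|]; last first.
  apply/setP=> x; apply/imsetP/idP => [[i _ ->]|xA]; first exact: enum_valP.
  by exists (enum_rank_in xA x); rewrite ?enum_rankK_in.
have sA : sorted ltn (map val (enum A)).
  rewrite sorted_map {1}/enum_mem; apply: sorted_filter.
    by move=> ? ? ? /=; apply: ltn_trans.
  by rewrite -enumT -sorted_map val_enum_ord iota_ltn_sorted.
have [x0 _] : exists x0 : 'I_n, True by exists (enum_val i).
rewrite /enum_val !(set_nth_default x0) -?cardE // -!(nth_map x0 0%N val) -?cardE //.
by apply: (sorted_ltn_nth ltn_trans) => //; rewrite inE size_map -cardE.
Qed.

Lemma set_extend (T : finType) (A : {set T}) k : (#|A| <= k <= #|T|)%N ->
  exists2 S : {set T}, A \subset S & #|S| = k.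
Proof.
case/andP=> Ak kT; pose s := take (k - #|A|) (enum (~: A)).
have ss x : x \in s -> x \notin A.
  by move/mem_take; rewrite mem_enum inE.
exists (A :|: [set x in s]); first exact: subsetUl.
rewrite cardsU (_ : A :&: _ = set0) ?cards0 ?subn0.
  rewrite cardsE (card_uniqP _) ?take_uniq ?enum_uniq // size_take -cardE.
  have := cardsC A; case: ltnP; lia.
apply/setP=> x; rewrite !inE; case: (boolP (x \in s)) => [/ss/negbTE->|]; by rewrite ?andbF.
Qed.

Lemma op_inj n n' (A : {set 'I_n}) (f : 'I_n -> 'I_n') :
  order_preserving_on A f -> {in A &, injective f}.
Proof.
move=> fA i j iA jA e; apply: val_inj.
have [ij|ji|//] := ltngtP i j; first by have := fA _ _ iA jA ij; rewrite e ltnn.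
by have := fA _ _ jA iA ji; rewrite e ltnn.
Qed.

(** The map [h] is [g] after the inverse of [f] on the image of [A]; the given point of ['I_p] is
    its default value elsewhere. *)
Lemma op_transport n n' p (A : {set 'I_n}) (f : 'I_n -> 'I_n') (g : 'I_n -> 'I_p) :
    'I_p -> order_preserving_on A f -> order_preserving_on A g ->
  exists2 h : 'I_n' -> 'I_p, order_preserving_on (f @: A) h &
    {in A, forall i, h (f i) = g i}.
Proof.
move=> z fA gA; pose h j := odflt z (omap g [pick i in A | f i == j]).
have hf i : i \in A -> h (f i) = g i.
  move=> iA; rewrite /h; case: pickP => [u /andP[uA /eqP e]|/(_ i)]; last first.
    by rewrite iA eqxx.
  by rewrite /=; congr g; apply: (op_inj fA).
exists h => // _ _ /imsetP[u uA ->] /imsetP[v vA ->] fuv; rewrite !hf //.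
apply: gA => //; case: (ltngtP u v) => // [/fA|/val_inj e]; last by rewrite e ltnn in fuv.
by move/(_ vA uA) => /(ltn_trans fuv); rewrite ltnn.
Qed.

(** * Relabelings of pairs and membership in order-invariant extensions *)

Section PCMap.
Variable r : nat.

(** The one condition of [is_pcperm] kept for general pairs: it survives unions and arbitrary
    relabelings, which injectivity does not. *)
Definition pc_wf n (P : pcperm r n) : bool := [set q.1 | q in P.2] == dom2 P.

Lemma dom1_map n n' (f : 'I_n -> 'I_n') (P : pcperm r n) :
  dom1 (pc_map f P) = f @: dom1 P.
Proof. by rewrite /dom1 -!imset_comp. Qed.

Lemma dom2_map n n' (f : 'I_n -> 'I_n') (P : pcperm r n) :
  dom2 (pc_map f P) = f @: dom2 P.
Proof. by rewrite /dom2 -!imset_comp. Qed.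

Lemma supp_map n n' (f : 'I_n -> 'I_n') (P : pcperm r n) :
  pc_supp (pc_map f P) = f @: pc_supp P.
Proof. by rewrite /pc_supp dom1_map dom2_map imsetU. Qed.

Lemma wf_map n n' (f : 'I_n -> 'I_n') (P : pcperm r n) : pc_wf P -> pc_wf (pc_map f P).
Proof.
move=> /eqP wP; apply/eqP; rewrite dom2_map -wP -!imset_comp.
by apply: eq_imset.
Qed.

Lemma wf_map_inj n n' (f : 'I_n -> 'I_n') (P : pcperm r n) :
  injective f -> pc_wf (pc_map f P) = pc_wf P.
Proof.
move=> fi; apply/idP/idP => [/eqP|]; last exact: wf_map.
rewrite dom2_map -imset_comp (_ : imset _ _ = f @: [set q.1 | q in P.2]).
  by move/(imset_inj fi)/eqP.
by rewrite -imset_comp; apply: eq_imset.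
Qed.

Lemma pc_map_comp n n' p (f : 'I_n -> 'I_n') (g : 'I_n' -> 'I_p) (P : pcperm r n) :
  pc_map g (pc_map f P) = pc_map (g \o f) P.
Proof. by rewrite /pc_map /= -!imset_comp. Qed.

Lemma mem_dom1 n (P : pcperm r n) e : e \in P.1 -> e.1 \in dom1 P.
Proof. by move=> eP; apply/imsetP; exists e. Qed.

Lemma mem_dom2 n (P : pcperm r n) e : e \in P.1 -> e.2 \in dom2 P.
Proof. by move=> eP; apply/imsetP; exists e. Qed.

Lemma wf_dom2 n (P : pcperm r n) q : pc_wf P -> q \in P.2 -> q.1 \in dom2 P.
Proof. by move=> /eqP<- qP; apply/imsetP; exists q. Qed.

Lemma eq_pc_map n n' (f g : 'I_n -> 'I_n') (P : pcperm r n) : pc_wf P ->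
  {in pc_supp P, f =1 g} -> pc_map f P = pc_map g P.
Proof.
move=> wP fg; congr pair; apply: eq_in_imset => e eP.
  by rewrite !fg // inE ?mem_dom1 ?mem_dom2 ?orbT.
by rewrite fg // inE wf_dom2 // orbT.
Qed.

Lemma pc_map_id n (P : pcperm r n) : pc_map id P = P.
Proof.
case: P => K k; rewrite /pc_map /=; congr pair.
  by rewrite -[RHS]imset_id; apply: eq_imset; case.
by rewrite -[RHS]imset_id; apply: eq_imset; case.
Qed.

Lemma pc_transport n n' p (P : pcperm r n) (f : 'I_n -> 'I_n') (g : 'I_n -> 'I_p) :
    'I_p -> pc_wf P -> order_preserving_on (pc_supp P) f ->
    order_preserving_on (pc_supp P) g ->
  exists2 h : 'I_n' -> 'I_p, order_preserving_on (pc_supp (pc_map f P)) h &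
    pc_map h (pc_map f P) = pc_map g P.
Proof.
move=> z wP fP gP; have [h hP hf] := op_transport z fP gP.
by exists h; rewrite ?supp_map // pc_map_comp; apply: eq_pc_map.
Qed.

Lemma pcperm_wf n (P : pcperm r n) : is_pcperm P -> pc_wf P.
Proof. by case=> _ _ _ /eqP. Qed.

Lemma increasing_on n n' (f : 'I_n -> 'I_n') A : increasing f -> order_preserving_on A f.
Proof. by move=> fi i j _ _; apply: fi. Qed.

(** Treats both cases of [oi_ext_set] at once, by pulling [P] back to [[n0]] instead of pushing
    members of [C] forward. Order invariance makes the choice of [g] immaterial. *)
Lemma oi_extP n0 (C : {set pcperm r n0}) n (P : pcperm r n) :
    'I_n0 -> order_invariant C ->
  P \in oi_ext_set C n <->
  pc_wf P /\ exists2 g : 'I_n -> 'I_n0, order_preserving_on (pc_supp P) g &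
                                      pc_map g P \in C.
Proof.
move=> z [Cpc _ Cinv]; rewrite /oi_ext_set; case: (leqP n n0) => nn0.
  rewrite inE; split=> [/existsP[f /andP[/forallP fE fP]]|[wP [g gop gP]]].
    have fi : increasing f by move=> i j; rewrite (eqP (fE i)) (eqP (fE j)).
    split; last by exists f => //; apply: increasing_on.
    by rewrite -(wf_map_inj _ (increasing_inj fi)); apply/pcperm_wf/Cpc.
  apply/existsP; exists (finfun (widen_ord nn0)); apply/andP; split.
    by apply/forallP=> i; rewrite ffunE.
  have wi : order_preserving_on (pc_supp P) (finfun (widen_ord nn0)).
    by move=> i j _ _; rewrite !ffunE.
  have [h hop <-] := pc_transport z wP gop wi.
  exact: Cinv.
rewrite inE; split=> [/existsP[f /andP[fi /existsP[Q /andP[QC /eqP->]]]]|[wP [g gop gP]]].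
  have wQ := pcperm_wf (Cpc _ QC).
  have {}fi : increasing f by move=> i j ij; move: fi => /forallP/(_ i)/forallP/(_ j)/implyP; apply.
  split; first exact: wf_map.
  have [h hop hQ] := pc_transport z wQ (@increasing_on _ _ _ (pc_supp Q) fi)
    (@increasing_on _ _ id _ (fun _ _ => id)).
  by exists h; rewrite // hQ pc_map_id.
(* As [g] embeds the support of [P] in [[n0]], that support lies in some [S] with exactly [n0]
   elements. The increasing enumeration [h] of [S] is the map wanted, with inverse [k] on [S]. *)
have [S PS S0] : exists2 S : {set 'I_n}, pc_supp P \subset S & #|S| = n0.
  apply: set_extend; rewrite card_ord (ltnW nn0) andbT -[leqRHS](card_ord n0).
  by rewrite -(card_in_imset (op_inj gop)) max_card.
have [h hi hS] := increasing_enum S0.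
have [k kop kh] := op_transport z (@increasing_on _ _ _ setT hi)
  (@increasing_on _ _ id setT (fun _ _ => id)).
have hk v : v \in pc_supp P -> h (k v) = v.
  by move/(subsetP PS); rewrite -hS => /imsetP[u _ ->]; rewrite kh.
apply/existsP; exists (finfun h); apply/andP; split.
  by apply/forallP=> i; apply/forallP=> j; apply/implyP; rewrite !ffunE; apply: hi.
apply/existsP; exists (pc_map k P); apply/andP; split; last first.
  apply/eqP; rewrite -[LHS]pc_map_id pc_map_comp; apply: eq_pc_map => // v /hk e.
  by rewrite /= ffunE.
have kP : order_preserving_on (pc_supp P) k.
  by move=> i j iP jP; apply: kop; rewrite hS (subsetP PS).
have [h' h'op <-] := pc_transport z wP gop kP.
exact: Cinv.
Qed.

Lemma oi_ext_map n0 (C : {set pcperm r n0}) n n' (f : 'I_n -> 'I_n') (P : pcperm r n) :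
    'I_n0 -> order_invariant C -> increasing f ->
  (pc_map f P \in oi_ext_set C n') = (P \in oi_ext_set C n).
Proof.
move=> z Cinv fi; have finj := increasing_inj fi.
apply/idP/idP => /(oi_extP _ z Cinv)[wP [g gop gP]]; apply/(oi_extP _ z Cinv).
  split; first by rewrite -(wf_map_inj _ finj).
  exists (g \o f); last by rewrite -pc_map_comp.
  move=> i j iP jP ij; apply: gop; rewrite ?supp_map ?imset_f //; exact: fi.
split; first exact: wf_map.
have [h hop hP] := pc_transport z wP (@increasing_on _ _ _ (pc_supp P) fi) gop.
by exists h; rewrite ?hP.
Qed.

End PCMap.

(** * Expansions in indicators with invariant coefficients *)

Section Expansions.
Variables (r : nat) (R : realType).

Definition pcU n (P Q : pcperm r n) : pcperm r n := (P.1 :|: Q.1, P.2 :|: Q.2).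

Lemma indicU n (P Q : pcperm r n) x :
  pc_indic (pcU P Q) x = pc_indic P x && pc_indic Q x.
Proof.
apply/andP/andP => [[/forall_inP H1 /forall_inP H2]|].
  by split; apply/andP; split; apply/forall_inP => e eP;
    [apply: H1|apply: H2|apply: H1|apply: H2]; rewrite inE eP ?orbT.
case=> /andP[/forall_inP H1 /forall_inP H2] /andP[/forall_inP H3 /forall_inP H4].
split; apply/forall_inP => e; rewrite inE => /orP[]; by auto.
Qed.

Lemma wfU n (P Q : pcperm r n) : pc_wf P -> pc_wf Q -> pc_wf (pcU P Q).
Proof. by move=> /eqP wP /eqP wQ; rewrite /pc_wf /dom2 !imsetU wP wQ. Qed.

Lemma sizeU n (P Q : pcperm r n) : (pc_size (pcU P Q) <= pc_size P + pc_size Q)%N.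
Proof. exact: leq_card_setU. Qed.

(** For injective [f] this inverts [pc_map f], whose image consists of the pairs satisfying
    [pc_in f]; it serves to reindex sums. *)
Definition pc_pre n n' (f : 'I_n -> 'I_n') (P : pcperm r n') : pcperm r n :=
  ([set e | (f e.1, f e.2) \in P.1], [set q | (f q.1, q.2) \in P.2]).

Lemma pc_mapK n n' (f : 'I_n -> 'I_n') : injective f -> cancel (@pc_map r _ _ f) (pc_pre f).
Proof.
move=> fi [K k]; rewrite /pc_pre; congr pair; apply/setP=> -[u v]; rewrite inE /=.
  by apply/imsetP/idP => [[[a b] ab [/fi-> /fi->]]|uv]; last by exists (u, v).
by apply/imsetP/idP => [[[a b] ab [/fi-> ->]]|uv]; last by exists (u, v).
Qed.

Definition pc_in n n' (f : 'I_n -> 'I_n') (P : pcperm r n') : bool :=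
  [forall e in P.1, (e.1 \in codom f) && (e.2 \in codom f)] &&
  [forall q in P.2, q.1 \in codom f].

Lemma pc_preK n n' (f : 'I_n -> 'I_n') (P : pcperm r n') :
  pc_in f P -> pc_map f (pc_pre f P) = P.
Proof.
case: P => K k /andP[/forall_inP /= HK /forall_inP /= Hk].
congr pair; apply/setP=> -[u v].
  apply/imsetP/idP => [[[a b] + [-> ->]]|uv]; first by rewrite inE.
  have /andP[/codomP[a ea] /codomP[b eb]] := HK _ uv.
  by exists (a, b); rewrite ?inE /= -?ea -?eb.
apply/imsetP/idP => [[[a b] + [-> ->]]|uv]; first by rewrite inE.
by have /codomP[a ea] := Hk _ uv; exists (a, v); rewrite ?inE /= -?ea.
Qed.

Lemma pc_in_map n n' (f : 'I_n -> 'I_n') (P : pcperm r n) : pc_in f (pc_map f P).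
Proof.
apply/andP; split; apply/forall_inP => _ /imsetP[e _ ->] /=; by rewrite !codom_f.
Qed.

Lemma pc_inU n n' (f : 'I_n -> 'I_n') (P Q : pcperm r n') :
  pc_in f (pcU P Q) = pc_in f P && pc_in f Q.
Proof.
apply/andP/andP => [[/forall_inP H1 /forall_inP H2]|].
  by split; apply/andP; split; apply/forall_inP => e eP;
    [apply: H1|apply: H2|apply: H1|apply: H2]; rewrite inE eP ?orbT.
case=> /andP[/forall_inP H1 /forall_inP H2] /andP[/forall_inP H3 /forall_inP H4].
split; apply/forall_inP => e; rewrite inE => /orP[]; by auto.
Qed.

Lemma pc_mapU n n' (f : 'I_n -> 'I_n') (P Q : pcperm r n) :
  pc_map f (pcU P Q) = pcU (pc_map f P) (pc_map f Q).
Proof. by rewrite /pc_map /pcU /= !imsetU. Qed.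

Definition coef_on (M : nat) (a : forall n, pcperm r n -> R) : Prop :=
  (forall n n' (f : 'I_n -> 'I_n') P, increasing f -> a n' (pc_map f P) = a n P) /\
  (forall n P, a n P != 0 -> pc_wf P && (pc_size P <= M)%N).

Definition expands (M : nat) (X : statistics r R) : Prop :=
  exists2 a, coef_on M a &
    forall n x, (1 <= n)%N -> X n x = \sum_P a n P * (pc_indic P x)%:R.

Lemma expands_oi_ext m Y : is_oi_ext m Y -> expands m Y.
Proof.
case=> n0 [C [n02 Cinv Cm ->]]; have z : 'I_n0 by case: n0 n02 {C Cinv Cm} => // n0 _; exact: ord0.
exists (fun n P => (P \in oi_ext_set C n)%:R); last first.
  move=> n x _; rewrite /oi_ext big_mkcond; apply: eq_bigr => P _.
  by case: ifP; rewrite ?mul1r ?mul0r.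
split=> [n n' f P fi|n P]; first by rewrite oi_ext_map.
rewrite pnatr_eq0 eqb0 negbK => /(oi_extP _ z Cinv)[wP [g gop gP]]; rewrite wP /=.
(* [g] is injective on the support, so [P] has as many edges as its image in [C]. *)
apply: leq_trans (Cm _ gP); rewrite /pc_size card_in_imset // => -[a b] [c d] ab cd [].
have [/= a1 c1] := (mem_dom1 ab, mem_dom1 cd).
have [/= b2 d2] := (mem_dom2 ab, mem_dom2 cd).
by move=> /(op_inj gop)-> => [/(op_inj gop)-> //|//|]; rewrite inE ?a1 ?c1 ?b2 ?d2 ?orbT.
Qed.

Lemma expands_in_I m X : in_I m X -> expands m X.
Proof.
case=> N [c [Y [Yoi XE]]].
have [a aP aX] := fin_all_exists2 (fun l => expands_oi_ext (Yoi l)).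
exists (fun n P => \sum_l c l * a l n P); first split.
- by move=> n n' f P fi; apply: eq_bigr => l _; rewrite (aP l).1.
- move=> n P; apply: contraR => nP; apply/eqP/big1 => l _.
  by apply/eqP; rewrite mulf_eq0; apply/orP; right; apply: contraR nP => /(aP l).2.
move=> n x n1; rewrite XE //; under [RHS]eq_bigr do rewrite mulr_suml.
rewrite exchange_big; apply: eq_bigr => l _; rewrite aX // mulr_sumr.
by apply: eq_bigr => P _; rewrite mulrA.
Qed.

(** The constant [1] is the indicator of the empty pair. *)
Lemma expands1 : expands 0 (fun _ _ => 1).
Proof.
exists (fun n P => (P == (set0, set0))%:R) => [|n x _]; first split.
- move=> n n' f [K k] _; congr (_%:R); rewrite /pc_map /= !xpair_eqE.
  by rewrite !imset_eq0.
- move=> n P; rewrite pnatr_eq0 eqb0 negbK => /eqP->.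
  by rewrite /pc_wf /dom2 /pc_size /= !imset0 cards0 eqxx.
rewrite (bigD1 (set0, set0)) //= eqxx mul1r big1 ?addr0 => [|P /negbTE->]; last by rewrite mul0r.
by rewrite /pc_indic /= (introT forall_inP) ?(introT forall_inP) // => e; rewrite inE.
Qed.

Lemma expandsM M N X Y :
  expands M X -> expands N Y -> expands (M + N) (fun n x => X n x * Y n x).
Proof.
move=> [a [ai aP] XE] [b [bi bP] YE].
exists (fun n P => \sum_(Q | pcU Q.1 Q.2 == P) a n Q.1 * b n Q.2) => [|n x n1]; first split.
- move=> n n' f P fi; have finj := increasing_inj fi.
  (* Both parts of a union that lies in the range of [f] lie in that range, so relabeling by [f] is
     a bijection from the decompositions of [P] to those of [pc_map f P]. *)
  rewrite (reindex_onto (fun Q => (pc_map f Q.1, pc_map f Q.2))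
                        (fun Q => (pc_pre f Q.1, pc_pre f Q.2))) /=; last first.
    move=> [Q Q'] /eqP /= e; have := pc_in_map f P; rewrite -e pc_inU => /andP[*].
    by rewrite !pc_preK.
  apply: eq_big => [[Q Q']|[Q Q'] _] /=; last by rewrite ai // bi.
  rewrite !pc_mapK // eqxx andbT -pc_mapU.
  by rewrite (inj_eq (can_inj (pc_mapK finj))).
- move=> n P; apply: contraR => nP; apply/eqP/big1 => -[Q Q'] /= /eqP e.
  apply/eqP; rewrite mulf_eq0; apply: contraR nP; rewrite negb_or -e.
  move=> /andP[/aP/andP[wQ sQ] /bP/andP[wQ' sQ']].
  by rewrite wfU // (leq_trans (sizeU _ _)) // leq_add.
rewrite XE // YE // mulr_suml; under eq_bigr do rewrite mulr_sumr.
rewrite pair_bigA /= (partition_big (fun Q => pcU Q.1 Q.2) xpredT) //=.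
apply: eq_bigr => P _; rewrite mulr_suml; apply: eq_bigr => Q /eqP <-.
by rewrite indicU mulrACA -natrM mulnb.
Qed.

Lemma expandsX M X k : expands M X -> expands (M * k) (fun n x => X n x ^+ k).
Proof.
move=> eX; elim: k => [|k IH]; first by rewrite muln0; exact: expands1.
have [a aP XE] := expandsM eX IH; rewrite mulnS.
by exists a => // n x n1; rewrite exprS XE.
Qed.

End Expansions.

Lemma imsetD1_in (T U : finType) (f : T -> U) (A : {set T}) a :
  {in A &, injective f} -> a \in A -> f @: (A :\ a) = (f @: A) :\ f a.
Proof.
move=> fi aA; apply/setP=> y; rewrite !inE; apply/imsetP/andP.
  move=> [x]; rewrite !inE => /andP[xa xA] ->; rewrite imset_f //; split=> //.
  by apply: contraNneq xa => /(fi _ _ xA aA)->.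
case=> ya /imsetP[x xA e]; exists x; rewrite // !inE xA andbT.
by apply: contraNneq ya => <-; apply/eqP.
Qed.

(** * Acyclic sets of edges *)

Section Acyclic.
Variable T : finType.
Implicit Types E L : {set T * T}.

(** For edges with distinct sources and distinct targets, a nonempty [L] whose sources and targets
    form the same set is a union of cycles, so this says that [E] is a disjoint union of paths. *)
Definition acyclic E : bool :=
  [forall L : {set T * T}, (L \subset E) && (L != set0) ==>
     ([set e.1 | e in L] != [set e.2 | e in L])].

Lemma acyclicP E : reflect
  (forall L, L \subset E -> L != set0 -> [set e.1 | e in L] != [set e.2 | e in L])
  (acyclic E).
Proof.
apply: (iffP forallP) => H L; last by apply/implyP=> /andP[]; apply: H.
by move=> LE L0; have /implyP := H L; apply; rewrite LE.
Qed.

Lemma acyclicS E E' : E \subset E' -> acyclic E' -> acyclic E.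
Proof. by move=> s /acyclicP H; apply/acyclicP => L LE; apply: H; apply: subset_trans s. Qed.

(* The excluded target [j0] is the first vertex of the path of [E] that ends at [i]:
   the set [B] of the ancestors of [i] has one element more than the set of edges
   pointing into [B]. *)
Lemma acyclic_add E i : {in E &, injective fst} -> {in E &, injective snd} ->
    acyclic E -> i \notin [set e.1 | e in E] ->
  exists2 j0, j0 \notin [set e.2 | e in E] &
    forall j, j \notin [set e.2 | e in E] -> acyclic ((i, j) |: E) = (j != j0).
Proof.
move=> E1 E2 /acyclicP Eac iE.
pose closed (B : {set T}) := (i \in B) && [forall e in E, (e.2 \in B) ==> (e.1 \in B)].
pose B : {set T} := \bigcap_(B : {set T} | closed B) B.
have Bmin D : closed D -> B \subset D by move=> cD; apply: bigcap_inf.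
have Bi : i \in B by apply/bigcapP=> D /andP[].
have Bc e : e \in E -> e.2 \in B -> e.1 \in B.
  move=> eE /bigcapP eB; apply/bigcapP => D cD; move: (cD) => /andP[_ /forall_inP/(_ e eE)/implyP].
  by apply; apply: eB.
pose L := [set e in E | e.2 \in B].
have LE : L \subset E by apply/subsetP=> e; rewrite inE => /andP[].
have iL : i \notin [set e.1 | e in L].
  by apply: contra iE; apply: (subsetP (imsetS _ LE)).
have BE : B = i |: [set e.1 | e in L].
  apply/eqP; rewrite eqEsubset; apply/andP; split; last first.
    apply/subsetP=> u /setU1P[->//|/imsetP[e + ->]].
    by rewrite inE => /andP[]; apply: Bc.
  apply: Bmin; rewrite /closed !inE eqxx; apply/forall_inP=> e eE; apply/implyP=> e2.
  rewrite inE imset_f ?orbT // inE eE /=; move: e2 => /setU1P[->//|].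
  by case/imsetP=> e'; rewrite inE => /andP[e'E e'B] ->; apply: Bc.
have L1 : {in L &, injective fst} by apply: sub_in2 E1; apply/subsetP.
have L2 : {in L &, injective snd} by apply: sub_in2 E2; apply/subsetP.
have cB : #|B| = #|L|.+1 by rewrite BE cardsU1 iL card_in_imset.
have LB : [set e.2 | e in L] \subset B.
  by apply/subsetP=> _ /imsetP[e + ->]; rewrite inE => /andP[].
have : #|B :\: [set e.2 | e in L]| == 1%N.
  by rewrite cardsD (setIidPr LB) cB card_in_imset // subSnn.
case/cards1P => j0 /setP j0P.
have j0B : j0 \in B by have := j0P j0; rewrite !inE eqxx => /andP[].
have j0E : j0 \notin [set e.2 | e in E].
  apply/negP=> /imsetP[e eE e2]; have := j0P j0; rewrite !inE eqxx => /andP[+ _].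
  by rewrite e2 imset_f // inE eE -e2.
exists j0 => // j jE; have [->|jj0] /= := eqVneq j j0.
  (* The sources and the targets of [L] together with [(i, j0)] both form [B], which violates
     acyclicity. *)
  apply/negP=> /acyclicP/(_ ((i, j0) |: L)) H.
  have /H : (i, j0) |: L \subset (i, j0) |: E by apply: setUS.
  have H0 : (i, j0) |: L != set0 by apply/set0Pn; exists (i, j0); rewrite !inE eqxx.
  move/(_ H0)/eqP; apply; rewrite !imsetU1 /= -BE.
  apply/setP=> u; have := j0P u; rewrite !inE; case: eqP => [-> /andP[_ ->]//|_ /=].
  case uL: (u \in [set e.2 | e in L]) => /=; last by move=> ->.
  by move=> _; apply: (subsetP LB).
apply/acyclicP => F FE F0.
have [iF|iF] := boolP ((i, j) \in F); last first.
  by apply: Eac => //; apply/subsetP => e eF; move/(subsetP FE): (eF); rewrite !inE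
    => /predU1P[e0|//]; rewrite e0 (negbTE iF) in eF.
(* A violating [F] contains [(i, j)]. Its targets then include [i] and are closed under
   predecessors, as [j] is not a target in [E]; so they include [B] and hence [j0], which is neither
   [j] nor a target in [E]. *)
apply/eqP => FD; pose D := [set e.2 | e in F].
have cD : closed D.
  rewrite /closed /D -{1}FD; apply/andP; split; first by apply/imsetP; exists (i, j).
  apply/forall_inP=> e eE; apply/implyP => /imsetP[e' e'F ee].
  rewrite -FD; apply/imsetP; exists e' => //; congr fst; apply: E2 => //.
  move/(subsetP FE): (e'F); rewrite !inE => /predU1P[e0|//].
  by case/negP: jE; apply/imsetP; exists e => //; rewrite ee e0.
have /imsetP[e eF ej0] := subsetP (Bmin _ cD) _ j0B.
move/(subsetP FE): (eF); rewrite !inE => /predU1P[e0|eE].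
  by rewrite ej0 e0 eqxx in jj0.
by case/negP: j0E; apply/imsetP; exists e.
Qed.

End Acyclic.

Lemma acyclic_map (T U : finType) (f : U -> T) (E : {set U * U}) :
  injective f -> acyclic [set (f e.1, f e.2) | e in E] = acyclic E.
Proof.
move=> fi; pose ff (e : U * U) := (f e.1, f e.2).
have im1 (L : {set U * U}) : [set e.1 | e in ff @: L] = f @: [set e.1 | e in L].
  by rewrite -!imset_comp.
have im2 (L : {set U * U}) : [set e.2 | e in ff @: L] = f @: [set e.2 | e in L].
  by rewrite -!imset_comp.
apply/acyclicP/acyclicP => H L.
  move=> LE L0; have := H (ff @: L).
  rewrite imsetS // imset_eq0 L0 im1 im2 => /(_ isT isT).
  by apply: contraNneq => ->.
move=> /subsetP LE L0; pose L' := [set e | ff e \in L].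
have LL : ff @: L' = L.
  apply/setP=> y; apply/imsetP/idP => [[e + ->]|yL]; first by rewrite inE.
  by have /imsetP[e _ ee] := LE _ yL; exists e; rewrite ?inE /ff -?ee.
have ffi : injective ff by move=> [a b] [c d] [/fi-> /fi->].
have := H L'; rewrite -LL im1 im2 (inj_eq (imset_inj fi)); apply; last first.
  by rewrite -(imset_eq0 ff) LL.
apply/subsetP=> e; rewrite inE => /LE.
by case/imsetP=> e' e'E /ffi->.
Qed.

(** * Disjoint unions of colored paths *)

Section Counting.
Variables r n : nat.
Implicit Types P Q : pcperm r n.

(** A partial colored permutation whose edges form disjoint paths. Comparing cardinalities encodes
    the injectivity conditions of [is_pcperm] as booleans. *)
Definition pc_forest P : bool :=
  [&& pc_wf P, #|dom1 P| == #|P.1|, #|dom2 P| == #|P.1|, #|P.2| == #|P.1|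
    & acyclic P.1].

Definition pc_add P i j c : pcperm r n := ((i, j) |: P.1, (j, c) |: P.2).

Lemma indic_add P i j c x :
  pc_indic (pc_add P i j c) x =
  [&& cp_perm x i == j, cp_col x j == c & pc_indic P x].
Proof.
apply/andP/and3P => [[/forall_inP H1 /forall_inP H2]|[e1 e2 /andP[]]].
  split; [by apply: (H1 (i, j)); rewrite setU11|by apply: (H2 (j, c)); rewrite setU11|].
  by apply/andP; split; apply/forall_inP => e eP; [apply: H1|apply: H2]; rewrite inE eP orbT.
move=> /forall_inP H1 /forall_inP H2; split; apply/forall_inP => e;
  rewrite inE => /orP[]; by [rewrite inE => /eqP-> | auto].
Qed.

Lemma dom1_add P i j c : dom1 (pc_add P i j c) = i |: dom1 P.
Proof. by rewrite /dom1 imsetU1. Qed.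

Lemma dom2_add P i j c : dom2 (pc_add P i j c) = j |: dom2 P.
Proof. by rewrite /dom2 imsetU1. Qed.

Lemma supp_add P i j c : pc_supp (pc_add P i j c) = i |: (j |: pc_supp P).
Proof. by rewrite /pc_supp dom1_add dom2_add setUACA [RHS]setUA. Qed.

Lemma wf_add P i j c : pc_wf P -> pc_wf (pc_add P i j c).
Proof. by move=> /eqP wP; rewrite /pc_wf dom2_add imsetU1 wP. Qed.

Lemma card_add P i j c : i \notin dom1 P -> #|(pc_add P i j c).1| = #|P.1|.+1.
Proof.
move=> iP; rewrite cardsU1 (_ : _ \notin _) //.
by apply: contra iP => /mem_dom1.
Qed.

Lemma forest_inj P : pc_forest P ->
  [/\ {in P.1 &, injective fst}, {in P.1 &, injective snd} & {in P.2 &, injective fst}].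
Proof.
case/and5P=> /eqP wP c1 c2 c3 _; split; apply/imset_injP => //.
by move: c3; rewrite wP (eqP c2) eq_sym.
Qed.

Lemma forest_add P i j c : pc_forest P -> i \notin dom1 P ->
  pc_forest (pc_add P i j c) = (j \notin dom2 P) && acyclic ((i, j) |: P.1).
Proof.
case/and5P=> wP c1 c2 c3 _ iP; rewrite /pc_forest wf_add // dom1_add dom2_add.
rewrite card_add // cardsU1 iP add1n eqSS c1 cardsU1 (eqP c2) /=.
case: (boolP (j \in dom2 P)) => [_|jP] /=.
  by rewrite add0n -(inj_eq succn_inj) eqn_leq ltnn andbF.
rewrite add1n eqxx cardsU1 (_ : _ \notin _) ?add1n ?eqSS ?c3 //.
by apply: contra jP => /(wf_dom2 wP).
Qed.

(** By acyclicity some target is not a source; it ends a path, and removing the last edge of that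
    path leaves a forest. *)
Lemma forest_leaf P : pc_forest P -> P.1 != set0 -> exists P' i j c,
  [/\ pc_forest P', P = pc_add P' i j c, i \notin dom1 P', j \notin pc_supp P' & i != j].
Proof.
move=> gP P0; case/and5P: (gP) => wP c1 c2 c3 aP.
have [i1 i2 i3] := forest_inj gP.
have : ~~ (dom2 P \subset dom1 P).
  apply: contra (acyclicP _ aP _ (subxx _) P0) => sP.
  by rewrite -/(dom1 P) -/(dom2 P) eq_sym eqEcard sP (eqP c1) (eqP c2) leqnn.
case/subsetPn => j j2 j1; have /imsetP[[i j'] ijP /= jj'] := j2; subst j'.
have : j \in [set q.1 | q in P.2] by rewrite (eqP wP).
case/imsetP => [[j' c]] jcP /= jj'; subst j'.
pose P' : pcperm r n := (P.1 :\ (i, j), P.2 :\ (j, c)).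
have d1 : dom1 P' = dom1 P :\ i by rewrite /dom1 imsetD1_in.
have d2 : dom2 P' = dom2 P :\ j by rewrite /dom2 imsetD1_in.
have iP : i \in dom1 P by apply: (mem_dom1 ijP).
have PE : P = pc_add P' i j c.
  by rewrite /pc_add /= !setD1K //; case: (P).
have cD1 (T : finType) (B : {set T}) b : b \in B -> #|B :\ b| = #|B|.-1.
  by move=> bB; rewrite (cardsD1 b B) bB.
exists P', i, j, c; split=> //; last by apply: contraNneq j1 => <-.
- apply/and5P; split.
  + by rewrite /pc_wf d2 imsetD1_in // (eqP wP).
  + by rewrite d1 !cD1 // (eqP c1).
  + by rewrite d2 !cD1 // (eqP c2).
  + by rewrite !cD1 // (eqP c3).
  + by apply: acyclicS aP; apply: subsetDl.
- by rewrite d1 !inE eqxx.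
- by rewrite inE d1 d2 !inE eqxx (negbTE j1) andbF.
Qed.

(** If the edges of a nonempty [L] have the same sources as targets, that set is stable under [x],
    so it contains a whole cycle and has more than [M] elements, while [P] has at most [M] edges. *)
Lemma indic_forest P x M : pc_wf P -> (#|P.1| <= M)%N ->
  (forall u, (M < #|porbit (cp_perm x) u|)%N) -> pc_indic P x -> pc_forest P.
Proof.
move=> wP PM xM /andP[/forall_inP H1 /forall_inP H2].
have c2 : #|dom2 P| = #|P.1|.
  apply: card_in_imset => -[a b] [c d] ab cd /= bd.
  have /eqP/= := H1 _ ab; have /eqP/= := H1 _ cd; rewrite -bd => <- /perm_inj-> //.
apply/and5P; split => //; last 1 first.
- apply/acyclicP=> L LP /set0Pn[e0 e0L]; apply/eqP => LD; pose D := [set e.1 | e in L].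
  have xD u : u \in D -> cp_perm x u \in D.
    by case/imsetP=> e eL ->; rewrite (eqP (H1 _ (subsetP LP _ eL))) /D LD imset_f.
  have : porbit (cp_perm x) e0.1 \subset D.
    apply/subsetP=> _ /porbitP[k ->]; elim: k => [|k IH].
      by rewrite expg0 perm1; apply: imset_f.
    by rewrite expgSr permM; apply: xD.
  move/subset_leq_card; rewrite leqNgt (leq_ltn_trans _ (xM e0.1)) //.
  by apply: leq_trans (leq_imset_card _ _) (leq_trans (subset_leq_card LP) PM).
- apply/eqP; apply: card_in_imset => -[a b] [c d] ab cd /= ac.
  by have /eqP/= := H1 _ ab; have /eqP/= := H1 _ cd; rewrite -ac => <- <-.
- by rewrite c2.
- rewrite -c2 -(eqP wP) card_in_imset // => -[a b] [c d] ab cd /= ac.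
  by have /eqP/= := H2 _ ab; have /eqP/= := H2 _ cd; rewrite -ac => <- <-.
Qed.

(** * Counting in a conjugation-stable set without short cycles *)

Section ConjugacyClass.
Variables (A : {set cperm r n}) (M : nat).
Hypothesis AJ : forall x g : cperm r n, x \in A -> (x ^ g)%g \in A.
Hypothesis AM : forall x u, x \in A -> (M < #|porbit (cp_perm x) u|)%N.

Definition pc_count P : nat := (\sum_(x in A) pc_indic P x)%N.

Lemma pc_count0 P : pc_wf P -> (#|P.1| <= M)%N -> ~~ pc_forest P -> pc_count P = 0%N.
Proof.
move=> wP PM nP; apply: big1 => x xA; case: (boolP (pc_indic P x)) => // iP.
by case/negP: nP; apply: (indic_forest wP PM _ iP) => u; apply: AM.
Qed.

(** Each [x] sends [i] to exactly one [j], with exactly one color. *)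
Lemma pc_count_add P i :
  pc_count P = (\sum_j \sum_c pc_count (pc_add P i j c))%N.
Proof.
rewrite pair_bigA exchange_big; apply: eq_bigr => x _ /=.
rewrite (bigD1 (cp_perm x i, cp_col x (cp_perm x i))) //= indic_add !eqxx /=.
rewrite big1 ?addn0 // => -[j c] /= ne; rewrite indic_add.
case: eqP => //= e1; case: eqP => //= e2; move: ne.
by rewrite -e2 -e1 eqxx.
Qed.

(* Conjugation by a transposition, with a color change at [j']. *)
Lemma pc_count_conj P i j j' c c' : pc_wf P ->
    j \notin i |: pc_supp P -> j' \notin i |: pc_supp P ->
  (pc_count (pc_add P i j c) <= pc_count (pc_add P i j' c'))%N.
Proof.
move=> wP jV j'V; pose g : cperm r n :=
  CPerm (tperm j j') [ffun u => if u == j' then c' - c else 0].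
rewrite /pc_count [leqRHS](reindex_inj (conjg_inj g)).
rewrite [leqRHS](eq_bigl (mem A)) /=; last first.
  move=> x; apply/idP/idP; last exact: AJ.
  by move/AJ => /(_ g^-1%g); rewrite conjgK.
apply: leq_sum => x _; case: (boolP (pc_indic (pc_add P i j c) x)) => //.
rewrite !indic_add => /and3P[/eqP xi /eqP cj /andP[/forall_inP H1 /forall_inP H2]].
have := (cp_conjP x (x ^ g)%g g).1 erefl; move: (x ^ g)%g => y H.
(* [g] fixes [i] and all vertices of [P], with color 0, so among the conditions imposed on [x]
   conjugation changes only the target of [i] and its color. *)
have gV u : u \in i |: pc_supp P -> tperm j j' u = u /\ cp_col g u = 0.
  move=> uV; rewrite tpermD ?ffunE; try by apply: contraTneq uV => <-.
  by split=> //; case: eqP => // uj; rewrite -uj uV in j'V.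
have [gi ci] : tperm j j' i = i /\ cp_col g i = 0 by apply: gV; rewrite !inE eqxx.
rewrite lt0b; apply/and3P; split.
- by have [+ _] := H i; rewrite xi /= gi tpermL => <-.
- have [e1 e2] := H i; move: e1 e2; rewrite xi /= gi tpermL => <-.
  by rewrite -[X in _ = X + _]/(cp_col g i) ci add0r cj ffunE eqxx addrC subrK => <-.
have HP e : e \in P.1 -> cp_perm y e.1 = e.2 /\ cp_col y e.2 = cp_col x e.2.
  move=> eP; have [g1 c1] : tperm j j' e.1 = e.1 /\ cp_col g e.1 = 0.
    by apply: gV; rewrite !inE (mem_dom1 eP) orbT.
  have [g2 c2] : tperm j j' e.2 = e.2 /\ cp_col g e.2 = 0.
    by apply: gV; rewrite !inE (mem_dom2 eP) !orbT.
  have [] := H e.1; rewrite (eqP (H1 _ eP)) /= g1 g2 => <-.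
  rewrite -[X in _ + X = _]/(cp_col g e.2) -[X in _ = X + _]/(cp_col g e.1).
  by rewrite c1 c2 addr0 add0r => ->.
apply/andP; split; apply/forall_inP=> e eP; first by rewrite (HP _ eP).1.
have /imsetP[e' e'P ee'] := wf_dom2 wP eP.
by rewrite ee' (HP _ e'P).2 -ee' H2.
Qed.

(* Among the ways to add an edge out of [i], with [j] a leaf outside the support,
   all those with target outside of the support are conjugate, those closing a
   cycle contribute nothing, and the others have a smaller support. *)
Lemma pc_count_forest P : pc_forest P -> (#|P.1| <= M)%N ->
  (pc_count P * (r.-1.+1 ^ #|P.1| * n.-1 ^_ #|P.1|))%N = #|A|.
Proof.
move sE : #|P.1| => s; elim: s P sE => [|s IHs] P.
  move=> s0 gP _; rewrite expn0 ffactn0 !muln1 -sum1_card; apply: eq_bigr => x _.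
  have /and5P[_ _ _ + _] := gP; rewrite s0 cards_eq0 => /eqP P2.
  move/eqP: s0; rewrite cards_eq0 => /eqP P1.
  by rewrite /pc_indic P1 P2 !(introT forall_inP) // => e; rewrite inE.
(* Inner induction on the size of the support, for a fixed number of edges. *)
have [d] := ubnP #|pc_supp P|; elim: d P => // d IHd P dP sP gP sM.
have P0 : P.1 != set0 by rewrite -card_gt0 sP.
have [P' [i [j [c [gP' PE iP' jP' ij]]]]] := forest_leaf gP P0.
have wP' : pc_wf P' by case/and5P: gP'.
have s' : #|P'.1| = s by move: sP; rewrite PE card_add // => -[].
have [i1 i2 _] := forest_inj gP'.
have aP' : acyclic P'.1 by case/and5P: gP'.
have [j0 j0P aj0] := acyclic_add i1 i2 aP' iP'.
rewrite -/(dom2 P') in j0P aj0.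
pose V := i |: pc_supp P'; set W := (_ ^ _ * _)%N.
have jV : j \notin V by rewrite !inE negb_or eq_sym ij -in_setU.
have cardadd j' c' : #|(pc_add P' i j' c').1| = s.+1 by rewrite card_add // s'.
(* By [acyclic_add], the targets in [J] are exactly those for which the new edge out of [i] gives a
   forest. *)
pose J := ~: (j0 |: dom2 P').
have cJ : (#|J| = n.-1 - s)%N.
  rewrite cardsCs setCK card_ord cardsU1 j0P.
  by have /and5P[_ _ /eqP-> _ _] := gP'; rewrite s'; lia.
have c0 j' c' : j' \notin J -> pc_count (pc_add P' i j' c') = 0%N.
  move=> j'J; apply: pc_count0; rewrite ?wf_add ?cardadd // forest_add // negb_and.
  case: (boolP (j' \in dom2 P')) => //= j'P; rewrite aj0 //.
  by move: j'J; rewrite !inE (negbTE j'P) orbF.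
(* Here the new support is [V], which lacks [j] and so is smaller than the support of [P]. *)
have cV j' c' : j' \in J :&: V -> (pc_count (pc_add P' i j' c') * W)%N = #|A|.
  rewrite !inE negb_or => /andP[/andP[j'j0 j'P] j'V].
  apply: IHd; rewrite ?cardadd // ?forest_add // ?aj0 ?j'P //.
  apply: leq_trans (dP : (_ <= d)%N).
  have eV u : i |: (u |: pc_supp P') = u |: V by apply: setUCA.
  rewrite PE !supp_add !eV [in ltnRHS]cardsU1 jV add1n ltnS (_ : j' |: V = V) //.
  by apply/setUidPr; rewrite sub1set !inE.
have cN j' c' : j' \in J :\: V -> pc_count (pc_add P' i j' c') = pc_count P.
  rewrite inE => /andP[j'V _]; rewrite PE; apply/eqP.
  by rewrite eqn_leq !pc_count_conj.
have JV0 : (0 < #|J :\: V|)%N.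
  apply/card_gt0P; exists j; rewrite inE jV !inE negb_or.
  move: gP; rewrite PE forest_add // => /andP[-> +].
  by rewrite andbT => ac; rewrite -aj0 //; move: jP'; rewrite inE negb_or => /andP[].
have [q qE] : exists q, r.-1.+1 = q by exists r.-1.+1.
move ey: (pc_count P * W)%N => y.
(* The count for [P'], known by induction, is split over the edges out of [i], then multiplied by
   [q (n - 1 - s)] so that each term carries the factor [W]. *)
have := IHs _ s' gP' (ltnW sM); rewrite (pc_count_add _ i).
rewrite (bigID (mem J)) /= addnC big1 => [|j' /c0 c0']; last by rewrite big1.
rewrite add0n (bigID (mem V)) /= => /(congr1 (muln^~ (q * (n.-1 - s)))%N).
rewrite -mulnA (_ : (_ * _ * (_ * _) = W)%N); last first.
  by rewrite /W -qE expnSr ffactnSr mulnACA.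
rewrite mulnDl !big_distrl.
rewrite (eq_bigr (fun=> q * #|A|)%N); last first.
  move=> j' j'V; rewrite big_distrl /= (eq_bigr (fun=> #|A|)).
    by rewrite sum_nat_const card_ord qE.
  by move=> c' _; apply: cV; rewrite in_setI.
rewrite (eq_bigl (fun u => u \in J :&: V)) => [|j']; last by rewrite in_setI.
rewrite [X in (_ + X)%N](eq_bigr (fun=> q * y)%N); last first.
  move=> j' /andP[j'J j'V]; rewrite big_distrl /= (eq_bigr (fun=> y)).
    by rewrite sum_nat_const card_ord qE.
  by move=> c' _; rewrite cN ?ey // in_setD j'V.
rewrite [X in (_ + X)%N](eq_bigl (fun u => u \in J :\: V)) => [|j']; last by rewrite in_setD andbC.
rewrite !sum_nat_const -cJ -(cardsID V J) !mulnDr.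
move: #|A| #|J :&: V| #|J :\: V| JV0 => a v w w0.
move=> e.
(* With [v + w] admissible targets, [v q a + w q y = (v + w) q a]; then [w > 0] gives [y = a]. *)
have : (w * (q * y) == w * (q * a))%N by lia.
by rewrite !eqn_pmul2l -?qE // => /eqP.
Qed.

End ConjugacyClass.
End Counting.

(** * Cycle classes, and sums over forests grouped by support *)

Lemma cycle_classJ r n lam (x g : cperm r n) :
  x \in cycle_class n lam -> (x ^ g)%g \in cycle_class n lam.
Proof. by rewrite !inE; apply: perm_trans; apply: cycle_typeJ. Qed.

Lemma cycle_class_porbit r n lam M (x : cperm r n) u :
    (forall l c, (1 <= l <= M)%N -> (l, c) \notin lam) ->
  x \in cycle_class n lam -> (M < #|porbit (cp_perm x) u|)%N.
Proof.
move=> lamM; rewrite inE => e; rewrite ltnNge; apply/negP=> uM.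
have := lamM #|porbit (cp_perm x) u| (\sum_(j in porbit (cp_perm x) u) cp_col x j).
rewrite porbit_gt0 uM -(perm_mem e) => /(_ isT)/negP; apply.
by apply/mapP; exists (porbit (cp_perm x) u) => //; rewrite mem_enum; apply/imsetP; exists u.
Qed.

Lemma forest_map r n n' (f : 'I_n -> 'I_n') (P : pcperm r n) :
  injective f -> pc_forest (pc_map f P) = pc_forest P.
Proof.
move=> fi; rewrite /pc_forest wf_map_inj // dom1_map dom2_map acyclic_map //.
have f1 : injective (fun e : 'I_n * 'I_n => (f e.1, f e.2)).
  by move=> [a b] [c d] [/fi-> /fi->].
have f2 : injective (fun q : 'I_n * Zcol r => (f q.1, q.2)).
  by move=> [a b] [c d] [/fi-> ->].
by rewrite !(card_imset _ fi) (card_imset _ f1) (card_imset _ f2).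
Qed.

(** Acyclicity, applied to the whole edge set, makes the sources and the targets two distinct sets
    of the same size, so their union is larger than either. *)
Lemma forest_supp r n (P : pcperm r n) : pc_forest P -> P.1 != set0 ->
  (#|P.1| < #|pc_supp P|)%N.
Proof.
case/and5P=> _ /eqP c1 /eqP c2 _ /acyclicP aP P0; have := aP _ (subxx _) P0.
rewrite -/(dom1 P) -/(dom2 P) => d12; rewrite -c1; apply: proper_card.
rewrite /pc_supp properE subsetUl subUset subxx /=.
by apply: contra d12 => d21; rewrite eq_sym eqEcard d21 c1 c2 leqnn.
Qed.

Lemma leq_card_supp r n (P : pcperm r n) : (#|pc_supp P| <= (pc_size P).*2)%N.
Proof.
by rewrite -addnn (leq_trans (leq_card_setU _ _)) // leq_add // leq_imset_card.
Qed.

Lemma sum_forest_supp (V : nmodType) r n (F : pcperm r n -> V) t (f : 'I_t -> 'I_n) :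
    increasing f ->
  \sum_(P | pc_forest P && (pc_supp P == f @: setT)) F P =
  \sum_(Q : pcperm r t | pc_forest Q && (pc_supp Q == setT)) F (pc_map f Q).
Proof.
move=> fi; have finj := increasing_inj fi.
rewrite (reindex_onto (pc_map f) (pc_pre f)) /=.
  apply: eq_bigl => Q; rewrite forest_map // supp_map (inj_eq (imset_inj finj)).
  by rewrite pc_mapK // eqxx andbT.
move=> P /andP[/and5P[wP _ _ _ _] /eqP sP]; apply: pc_preK.
have cod u : u \in pc_supp P -> u \in codom f.
  by rewrite sP => /imsetP[i _ ->]; apply: codom_f.
apply/andP; split; apply/forall_inP => e eP.
  by rewrite !cod // inE ?(mem_dom1 eP) ?(mem_dom2 eP) ?orbT.
by rewrite cod // inE (wf_dom2 wP eP) orbT.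
Qed.

Lemma sum_card_sets (S : pzSemiRingType) n N (G : nat -> S) :
    (forall t, (N < t)%N -> G t = 0) ->
  \sum_(T : {set 'I_n}) G #|T| = \sum_(t < N.+1) 'C(n, t)%:R * G t.
Proof.
move=> GN; transitivity (\sum_(T : {set 'I_n}) \sum_(t < N.+1) (#|T| == t)%:R * G t).
  apply: eq_bigr => T _; have [TN|TN] := ltnP N #|T|.
    rewrite GN // big1 // => t _; rewrite gtn_eqF ?mul0r //.
    by apply: leq_ltn_trans TN; rewrite -ltnS.
  rewrite (bigD1 (Ordinal (TN : (_ < N.+1)%N))) //= eqxx mul1r big1 ?addr0 // => t.
  by rewrite eq_sym -val_eqE /= => /negbTE->; rewrite mul0r.
rewrite exchange_big; apply: eq_bigr => t _; rewrite -mulr_suml; congr (_ * _).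
rewrite -natr_sum -[n in RHS]card_ord -card_draws -sum1dep_card [in RHS]big_mkcond.
by congr (_%:R); apply: eq_bigr => T _; case: eqP.
Qed.

Lemma ffactD n s k : (n ^_ (s + k) = n ^_ s * (n - s) ^_ k)%N.
Proof.
elim: k => [|k IH]; first by rewrite addn0 ffactn0 muln1.
by rewrite addnS !ffactnSr IH subnDA mulnA.
Qed.

(** * Polynomial weights *)

Section Weight.
Variables (R : realType) (q : nat).

(** The quotient [C(n, t) / (q^s (n-1) ... (n-s))] as a polynomial in [n]: for [0 < s < t] the
    denominator cancels against [n (n-1) ... (n-t+1)] and leaves [n (n-s-1) ... (n-t+1)]. With
    [s = 0] only [t = 0] is of interest, where the quotient is 1. *)
Definition weight_poly t s : {poly R} :=
  if s == 0%N then 1 else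
  ((t`! * q ^ s)%:R^-1) *: ('X * \prod_(i < t.-1 - s) ('X - (s.+1 + i)%:R%:P)).

Lemma size_weight_poly t s : (s < t)%N || (s == 0%N) -> (size (weight_poly t s) <= (t - s).+1)%N.
Proof.
rewrite /weight_poly; case: eqP => [_ _|_]; first by rewrite size_poly1.
rewrite orbF => st; apply: leq_trans (size_scale_leq _ _) _.
rewrite mulrC size_mulX ?monic_neq0 ?monic_prod_XsubC // size_prod_XsubC.
rewrite -[index_enum _]enumT size_enum_ord; lia.
Qed.

Lemma horner_weight_poly t s n : (0 < q)%N -> (s < n)%N ->
    (0 < s < t)%N || ((s == 0%N) && (t == 0%N)) ->
  (weight_poly t s).[n%:R] = 'C(n, t)%:R / (q ^ s * n.-1 ^_ s)%:R.
Proof.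
move=> q0 sn; rewrite /weight_poly; case: eqP => [->|/eqP s0] /=.
  by move=> /eqP->; rewrite ?hornerC ?bin0 ?expn0 ?ffactn0 ?divr1.
rewrite orbF; case: t => [/andP[]//|t /andP[_]]; rewrite ltnS => st.
have n1 : (n.-1 - s).+1 = (n - s)%N by lia.
have prodE k : (\prod_(i < k) ('X - (s.+1 + i)%:R%:P)).[n%:R] = ((n.-1 - s) ^_ k)%:R :> R.
  elim: k => [|k IH]; first by rewrite big_ord0 hornerC.
  rewrite big_ord_recr /= hornerM IH hornerXsubC ffactnSr natrM.
  (* Past [n - 1 - s] both sides are already zero; up to it the natural subtractions are exact. *)
  have [kn|kn] := leqP k (n.-1 - s); last by rewrite ffact_small ?mul0r.
  by rewrite -natrB ?subnDA -?n1; [congr (_ * _%:R); lia | lia].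
rewrite hornerZ hornerM hornerX prodE.
have tE : ('C(n, t.+1) * t.+1`! = n * (n.-1 ^_ s * (n.-1 - s) ^_ (t - s)))%N.
  by rewrite bin_ffact ffactnS -ffactD subnKC.
have f0 : (t.+1`!)%:R != 0 :> R by rewrite pnatr_eq0 -lt0n fact_gt0.
have q0' : (q ^ s)%:R != 0 :> R by rewrite pnatr_eq0 -lt0n expn_gt0 q0.
have g0 : (n.-1 ^_ s)%:R != 0 :> R by rewrite pnatr_eq0 -lt0n ffact_gt0; lia.
move: (t.+1`!) tE f0 => F tE f0.
apply: (mulfI f0); rewrite [RHS]mulrA [X in _ = X / _]mulrC -[X in _ = X / _]natrM tE !natrM /=.
by field; rewrite f0 q0' g0.
Qed.

End Weight.

(** * Assembling the polynomial *)

Lemma sum_by_support (V : pzSemiRingType) r n N (F : pcperm r n -> V) (G : nat -> V) :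
    (forall t, (N < t)%N -> G t = 0) ->
    (forall t (f : 'I_t -> 'I_n), increasing f ->
       \sum_(Q : pcperm r t | pc_forest Q && (pc_supp Q == setT)) F (pc_map f Q) = G t) ->
  \sum_(P | pc_forest P) F P = \sum_(t < N.+1) 'C(n, t)%:R * G t.
Proof.
move=> GN FG; rewrite -sum_card_sets //.
rewrite (partition_big (@pc_supp r n) xpredT) //=; apply: eq_bigr => T _.
(* The increasing enumeration of [T] identifies it with [[t]], so the inner sum depends only on the
   size of [T]. *)
by have [f fi <-] := increasing_enum (erefl #|T|); rewrite sum_forest_supp // FG // card_imset
  ?cardsT ?card_ord //; apply: increasing_inj.
Qed.

Theorem theorem3p32 (R : realType) (r m : nat) (hr : (1 <= r)%N) (hm : (1 <= m)%N)
    (X : statistics r R) (hX : in_I m X) (k : nat) (hk : (1 <= k)%N) :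
  exists2 p : {poly R}, (size p <= (m * k).+1)%N &
    forall (n : nat) (lam : seq (nat * Zcol r)),
      (1 <= n)%N ->
      cycle_class n lam != set0 ->
      (forall l c, (1 <= l <= m * k)%N -> (l, c) \notin lam) ->
      p.[n%:R] = expectation (cycle_class n lam) (fun x => X n x ^+ k).
Proof.
have [a [ainv asupp] aX] := expandsX k (expands_in_I hX).
set N := (m * k)%N in asupp *; pose q := r.-1.+1.
(* A forest without edges has empty support, which forces [t = 0]. *)
have sizeP t (Q : pcperm r t) : pc_forest Q -> pc_supp Q == setT ->
    (0 < #|Q.1| < t)%N || (#|Q.1| == 0%N) && (t == 0%N).
  move=> gQ /eqP sQ; have := leq_card_supp Q; have := forest_supp gQ.
  rewrite sQ cardsT card_ord -card_gt0 /pc_size.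
  by case: posnP => [->|_ ->] //; rewrite leqn0 => _ ->.
(* Only forests of full support in [[t]] enter, so the polynomial depends neither on [n] nor on the
   class; [2N] bounds the support of a pair of size at most [N]. *)
exists (\sum_(t < N.*2.+1) \sum_(Q : pcperm r t | pc_forest Q && (pc_supp Q == setT))
          a t Q *: weight_poly R q t #|Q.1|).
  apply: (leq_trans (size_sum _ _ _)); apply/bigmax_leqP => t _.
  apply: (leq_trans (size_sum _ _ _)); apply/bigmax_leqP => Q /andP[gQ sQ].
  have [->|/asupp/andP[_ QN]] := eqVneq (a t Q) 0; first by rewrite scale0r size_poly0.
  apply: leq_trans (size_scale_leq _ _) _; have st := sizeP _ _ gQ sQ.
  apply: leq_trans (size_weight_poly _ _ _) _.
    by case/orP: st => /andP[]; [move=> _ ->|move=> ->; rewrite orbT].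
  have := leq_card_supp Q; rewrite (eqP sQ) cardsT card_ord /pc_size in QN *; lia.
move=> n lam n1 A0 lamN; set A := cycle_class n lam in A0 *.
have [x0 x0A] := set0Pn _ A0.
have AM x u : x \in A -> (N < #|porbit (cp_perm x) u|)%N by apply: cycle_class_porbit.
(* The class has an element, all of whose cycles are longer than [N]. Hence [s < n] for every size
   [s] that occurs, as [horner_weight_poly] requires. *)
have Nn : (N < n)%N.
  apply: leq_trans (AM x0 (Ordinal n1) x0A) _.
  by rewrite -[leqRHS](card_ord n) max_card.
pose w s : R := ((q ^ s * n.-1 ^_ s)%:R)^-1.
have countE P : pc_wf P && (pc_size P <= N)%N ->
    (pc_count A P)%:R / #|A|%:R = if pc_forest P then w #|P.1| else 0.
  case/andP=> wP PN; case: ifP => [gP|/negbT gP]; last by rewrite (pc_count0 AM) ?mul0r.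
  have A0' : #|A|%:R != 0 :> R by rewrite pnatr_eq0 cards_eq0.
  have := pc_count_forest (@cycle_classJ r n lam) AM gP PN.
  rewrite -/A -/q => e; have e' := congr1 (fun u => u%:R : R) e.
  (* Nonzero because its product with the count is the size of the nonempty class. *)
  have W0 : (q ^ #|P.1| * n.-1 ^_ #|P.1|)%:R != 0 :> R.
    by apply: contraNneq A0' => W0; rewrite -e natrM W0 mulr0.
  by apply: (mulIf W0); rewrite mulVf // mulrAC -natrM e divff.
rewrite /expectation; under [in RHS]eq_bigr do rewrite aX //.
rewrite exchange_big /= mulr_suml.
(* The other pairs drop out: their coefficient or their mean is zero. *)
transitivity (\sum_(P : pcperm r n | pc_forest P) a n P * w #|P.1|); last first.
  rewrite big_mkcond; apply: eq_bigr => P _; rewrite -mulr_sumr -natr_sum -mulrA.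
  have [->|/asupp/countE->] := eqVneq (a n P) 0; first by rewrite !mul0r if_same.
  by case: ifP; rewrite ?mulr0.
pose G t := \sum_(Q : pcperm r t | pc_forest Q && (pc_supp Q == setT)) a t Q * w #|Q.1|.
rewrite (@sum_by_support _ _ _ N.*2 _ G).
- rewrite horner_sum; apply: eq_bigr => t _; rewrite horner_sum mulr_sumr.
  apply: eq_bigr => Q /andP[gQ sQ]; rewrite hornerZ mulrCA.
  have [->|/asupp/andP[_ QN]] := eqVneq (a t Q) 0; first by rewrite !mul0r.
  by rewrite horner_weight_poly ?(sizeP _ _ gQ sQ) //; apply: leq_ltn_trans QN Nn.
- move=> t tN; apply: big1 => Q /andP[_ /eqP sQ].
  have [->|/asupp/andP[_ QN]] := eqVneq (a t Q) 0; first by rewrite mul0r.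
  have := leq_card_supp Q; rewrite sQ cardsT card_ord leqNgt (leq_ltn_trans _ tN) //.
  by rewrite leq_double.
(* Invariance of [a] makes the sum the same for every support of size [t]. *)
move=> t f fi; apply: eq_bigr => Q _; rewrite ainv //; congr (_ * w _).
by apply: card_imset => -[u v] [u' v'] [/(increasing_inj fi)-> /(increasing_inj fi)->].
Qed.
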